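(* Let $d_1,\dots,d_S\ge1$, $d=d_1+\cdots+d_S$, and let $P$ be a $d\times d$ block homogeneous correlation matrix with parameters $\rho_{s_1s_2}$, $s_1,s_2\in\{1,\dots,S\}$, such that $1+(d_s-1)\rho_{ss}\neq0$ for all $s$. Let $M=(m_{s_ks_l})$ be the $S\times S$ matrix with $m_{ss}=1$, $s=1,\dots,S$, and $$m_{s_ks_l}=\frac{d_{s_k}d_{s_l}\,\rho_{s_ks_l}}{(1+(d_{s_k}-1)\rho_{s_ks_k})(1+(d_{s_l}-1)\rho_{s_ls_l})},\quad s_k,s_l\in\{1,\dots,S\},\ s_k\ne s_l.$$ If $M\in\mathcal{S}_S$, then $P$ is $\rho_{\mathrm S}$-compatible. Moreover, if $M$ is $\rho_{\mathrm S}$-attainable, so is $P$.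
   Context: A block homogeneous matrix is a symmetric matrix in $[-1,1]^{d\times d}$ with unit diagonal of the form $P=(P_{s_1s_2})_{s_1,s_2=1}^S$ with blocks $P_{ss}=(1-\rho_{ss})I_{d_s}+\rho_{ss}J_{d_s}$ and, for $s_1\neq s_2$, $P_{s_1s_2}=\rho_{s_1s_2}J_{d_{s_1}d_{s_2}}$, where $I_n$ is the identity, $J_{nm}$ the $n\times m$ matrix of ones, $J_n=J_{nn}$, and $\rho_{s_1s_2}=\rho_{s_2s_1}$. It is a block homogeneous correlation matrix if it is in addition positive semi-definite. Spearman's rho of $(X_1,X_2)$ with continuous margins $F_1,F_2$ is $\rho_{\mathrm S}(X_1,X_2)=\rho(F_1(X_1),F_2(X_2))$ with $\rho$ Pearson's correlation. A matrix $Q\in[-1,1]^{n\times n}$ is $\rho_{\mathrm S}$-compatible if there is an $n$-dimensional random vector $\boldsymbol{X}$ with continuous margins with $Q=(\rho_{\mathrm S}(X_i,X_j))_{i,j}$; $\mathcal{S}_n$ denotes the set of all such matrices $Q$. A $\rho_{\mathrm S}$-compatible matrix $Q$ is $\rho_{\mathrm S}$-attainable if one can construct such a random vector $\boldsymbol{X}$. *)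

(* Defs.v *)
(* MathComp / MathComp-Analysis. *)
From HB Require Import structures.
From mathcomp Require Import all_boot all_order all_algebra.
From mathcomp Require Import all_classical all_reals all_analysis.

Set Implicit Arguments.
Unset Strict Implicit.
Unset Printing Implicit Defensive.

Import Order.TTheory GRing.Theory Num.Theory.
Import numFieldNormedType.Exports.

Local Open Scope classical_set_scope.
Local Open Scope ring_scope.

Definition entries_in_pm1 (R : realType) (n : nat) (Q : 'M[R]_n) : Prop :=
  forall i j, -1 <= Q i j <= 1.

Definition psd_mx (R : realType) (n : nat) (Q : 'M[R]_n) : Prop :=
  forall x : 'cV[R]_n, 0 <= (x^T *m Q *m x) 0 0.

Section SpearmanRho.
Context (disp : measure_display) (T : measurableType disp) (R : realType)
  (Pr : probability T R).

Definition pearson (U V : T -> R) : R :=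
  fine (covariance Pr U V)
    / (Num.sqrt (fine (variance Pr U)) * Num.sqrt (fine (variance Pr V))).

Definition df (X : {RV Pr >-> R}) (x : R) : R := fine (cdf X x).

Definition spearman (X Y : {RV Pr >-> R}) : R :=
  pearson (fun t => df X (X t)) (fun t => df Y (Y t)).

(* A random vector is given by the family of its components. *)
Definition has_rhoS_matrix (n : nat) (X : 'I_n -> {RV Pr >-> R})
    (Q : 'M[R]_n) : Prop :=
  (forall i, continuous (df (X i))) /\
  (forall i j, Q i j = spearman (X i) (X j)).

End SpearmanRho.

Definition rhoS_compatible (R : realType) (n : nat) (Q : 'M[R]_n) : Prop :=
  entries_in_pm1 Q /\
  exists (disp : measure_display) (T : measurableType disp)
         (Pr : probability T R) (X : 'I_n -> {RV Pr >-> R}),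
    has_rhoS_matrix X Q.

Definition rhoS_set (R : realType) (n : nat) : set 'M[R]_n :=
  [set Q | rhoS_compatible Q].
Arguments rhoS_set {R} n.

(* "One can construct such a random vector X" is read as: X has a stochastic
   representation X = phi(U) with U uniform on [0, 1] and phi measurable, that
   is, X lives on the sample space R carrying the law of U.  A single U is no
   restriction compared with a sequence of independent uniforms, since such a
   sequence can be extracted from the binary digits of U. *)
Definition rhoS_attainable (R : realType) (n : nat) (Q : 'M[R]_n) : Prop :=
  rhoS_compatible Q /\
  exists X : 'I_n -> {RV (uniform_prob (@ltr01 R)) >-> R}, has_rhoS_matrix X Q.

Section BlockHomogeneous.
Context (R : realType) (S : nat) (d : 'I_S -> nat) (rho : 'M[R]_S).

(* Row and column indices of P run over the concatenation of the S groups;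
   submxblock P s t is the d s x d t block in block position (s, t). *)
Definition block_homogeneous (P : 'M[R]_(\sum_s d s)) : Prop :=
  [/\ P^T = P,
      entries_in_pm1 P,
      (forall i, P i i = 1),
      (forall s, submxblock P s s
                 = (1 - rho s s) *: 1%:M + rho s s *: const_mx 1)
    & (forall s t, s != t -> submxblock P s t = rho s t *: const_mx 1)].

Definition block_homogeneous_corr (P : 'M[R]_(\sum_s d s)) : Prop :=
  block_homogeneous P /\ psd_mx P.

Definition block_reduction : 'M[R]_S :=
  \matrix_(k, l)
    if k == l then 1 else
      (d k)%:R * (d l)%:R * rho k l
        / ((1 + ((d k)%:R - 1) * rho k k) * (1 + ((d l)%:R - 1) * rho l l)).

End BlockHomogeneous.

(* Main.v *)
Require Import Defs.
From HB Require Import structures.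
From mathcomp Require Import all_boot all_order all_algebra all_fingroup.
From mathcomp Require Import all_classical all_reals all_analysis.
From mathcomp Require Import measurable_realfun ring lra.

Set Implicit Arguments.
Unset Strict Implicit.
Unset Printing Implicit Defensive.

Import Order.TTheory GRing.Theory Num.Theory.
Import numFieldNormedType.Exports.

Local Open Scope classical_set_scope.
Local Open Scope ring_scope.

(** The matrix M of the statement is the Spearman matrix of some vector
    (Y_1, ..., Y_S).  Its probability integral transforms U_s = F_s(Y_s) are
    uniform on [0, 1], and M_st = 12 E[U_s U_t] - 3
    (is_uniform_df, pearson_uniform).  From the U_s one builds a vector with
    Spearman matrix P as follows.

    Put c_s = (1 + (d_s - 1) rho_ss) / d_s.  Positive semi-definiteness of P,
    tested on the indicator vector of block s, gives c_s >= 0, and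
    rho_ss <= 1 gives c_s <= 1.  Independently for each s,
    - with probability c_s, all the components of block s are set to U_s;
    - with probability 1 - c_s, the i-th component of block s is set to
      f_(pi i)(U_s), where pi is a uniformly random permutation of the block
      and f_1, ..., f_(d_s) are maps of [0, 1] preserving the uniform law
      whose sum is the constant d_s / 2 (if d_s = 1, then c_s = 1 and this
      case does not occur).
    Every component is uniform.  Given (U_s)_s, the conditional mean of a
    component of block s is c_s U_s + (1 - c_s) / 2, since the f_j average to
    1 / 2; hence two components in different blocks s and t have Spearman's
    rho c_s c_t M_st = rho_st (comoment_across).  Two distinct components of
    block s have Spearman's rho equal to 1 with weight c_s and
    - 1 / (d_s - 1) with weight 1 - c_s, because the f_j have a constant sum
    and are exchanged at random; the total is
    c_s - (1 - c_s) / (d_s - 1) = rho_ss (comoment_within).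

    The only randomness needed beyond (Y_s) is a finitely supported variable
    independent of it.  For compatibility it is read off an additional
    uniform coordinate (splits_product).  For attainability the uniform
    variable itself has to be split: cutting [0, 1] into intervals of lengths
    w_k and rescaling each of them to [0, 1] yields an index of law w and an
    independent uniform variable (splits_uniform). *)

(** * Uniform-preserving maps with a constant sum *)

Section JointMix.
Context (R : realFieldType).
Implicit Types (u : R) (N r : nat).

(** On [0, 1], the map u |-> u + 1 / 2 modulo 1. *)
Definition shift_half u : R := if u < 1 / 2 then u + 1 / 2 else u - 1 / 2.

(** The map completing u and [shift_half u] to a triple of sum 3 / 2; it is
    1 - 2 u for u < 1 / 2 and 2 - 2 u otherwise. *)
Definition triple_rest u : R := 3 / 2 - u - shift_half u.

(** [joint_mix N r] is the r-th of N maps (r < N) that preserve the uniform law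
    on [0, 1] and, for N >= 2, sum to N / 2: the antithetic maps u and 1 - u
    alternate, and for odd N the first three maps are a triple of sum 3 / 2.
    For every r, even out of range, the map preserves the uniform law. *)
Definition joint_mix N r u : R :=
  if odd N && (r < 3)%N then
    match r with 0 => u | 1 => shift_half u | _ => triple_rest u end
  else if odd r then 1 - u else u.

Lemma sum_antithetic (m r0 : nat) u :
  \sum_(r < m.*2) (if odd (r + r0) then 1 - u else u) = m%:R.
Proof.
elim: m => [|m IHm]; first by rewrite big_ord0.
rewrite doubleS 2!big_ord_recr/= IHm -natr1.
by case: (odd (m.*2 + r0)) => /=; lra.
Qed.

Lemma sum_joint_mix N u : (2 <= N)%N ->
  \sum_(r < N) joint_mix N r u = N%:R / 2.
Proof.
move=> N2; have [oddN|evenN] := boolP (odd N); last first.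
  have [m ->] : exists m, N = m.*2 by exists N./2; rewrite even_halfK.
  under eq_bigr do rewrite /joint_mix odd_double /= -[X in odd X]addn0.
  by rewrite sum_antithetic -muln2 natrM mulfK// pnatr_eq0.
(* The triple contributes 3 / 2; the remaining maps are antithetic pairs. *)
have [m ->] : exists m, N = (3 + m.*2)%N.
  case: N oddN N2 => [|[|[|N]]]//= oN _.
  by exists N./2; rewrite even_halfK//; move: oN; rewrite !negbK.
rewrite big_split_ord/= !big_ord_recr big_ord0/=.
have -> : \sum_(r < m.*2) joint_mix (3 + m.*2) (3 + r) u = m%:R.
  rewrite -(sum_antithetic m 3 u); apply: eq_bigr => r _.
  by rewrite /joint_mix !addSn add0n addn3 /= andbF.
rewrite /joint_mix !oddD odd_double /= /triple_rest.
by rewrite natrD -muln2 natrM; field.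
Qed.

End JointMix.

(** * Averages over the permutations of a finite set *)

Section PermSum.
Context (R : numFieldType) (n : nat) (A : {set 'I_n}).

Lemma perm_sum_reindex (s : 'S_n) (F : 'S_n -> R) : perm_on A s ->
  \sum_(p in Sym A) F p = \sum_(p in Sym A) F (s * p)%g.
Proof.
move=> sA; rewrite (reindex_inj (mulgI s))/=.
by apply: eq_bigl => p; rewrite groupMl// inE.
Qed.

Lemma tperm_Sym i j : i \in A -> j \in A -> perm_on A (tperm i j).
Proof.
move=> iA jA; apply/fintype.subsetP => k; rewrite inE.
by case: tpermP => [->|->|_ _]; rewrite ?eqxx.
Qed.

Lemma card_Sym_gt0 : 0 < #|Sym A|%:R :> R.
Proof. by rewrite ltr0n; apply/card_gt0P; exists 1%g; rewrite group1. Qed.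

Lemma sum_perm_image (f : 'I_n -> R) (p : 'S_n) : p \in Sym A ->
  \sum_(i in A) f (p i) = \sum_(i in A) f i.
Proof.
rewrite inE => pA; rewrite [RHS](reindex_inj (@perm_inj _ p))/=.
by apply: eq_bigl => i; rewrite perm_closed.
Qed.

(** A random permutation of A sends any given point of A to a uniformly
    distributed one. *)
Lemma mean_Sym (f : 'I_n -> R) i : i \in A ->
  (\sum_(p in Sym A) f (p i)) / #|Sym A|%:R = (\sum_(j in A) f j) / #|A|%:R.
Proof.
move=> iA; have A0 : #|A|%:R != 0 :> R.
  by rewrite pnatr_eq0 -lt0n; apply/card_gt0P; exists i.
have S0 := lt0r_neq0 card_Sym_gt0.
(* By left translation by a transposition, the sum does not depend on i. *)
have eqi j : j \in A ->
    \sum_(p in Sym A) f (p j) = \sum_(p in Sym A) f (p i).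
  move=> jA; rewrite (perm_sum_reindex (fun p => f (p j)) (tperm_Sym iA jA)).
  by apply: eq_bigr => p _; rewrite permM tpermR.
have : \sum_(j in A) \sum_(p in Sym A) f (p j)
     = #|A|%:R * \sum_(p in Sym A) f (p i).
  by under eq_bigr => j jA do rewrite (eqi j jA); rewrite sumr_const mulr_natl.
rewrite exchange_big/=.
under eq_bigr => p pA do rewrite (sum_perm_image f pA).
rewrite sumr_const -[X in X = _]mulr_natl => e.
by apply/eqP; rewrite eqr_div// [eqbLHS]mulrC -e [eqbLHS]mulrC.
Qed.

(** A random permutation of A sends any two given distinct points of A to a
    uniformly distributed pair of distinct points. *)
Lemma mean_Sym2 (f : 'I_n -> R) i j : i \in A -> j \in A -> i != j ->
  (\sum_(p in Sym A) f (p i) * f (p j)) / #|Sym A|%:R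
  = ((\sum_(k in A) f k) ^+ 2 - \sum_(k in A) f k ^+ 2)
    / (#|A|%:R * (#|A|%:R - 1)).
Proof.
move=> iA jA ij.
have S0 := lt0r_neq0 card_Sym_gt0.
have A2 : (2 <= #|A|)%N.
  by rewrite (cardD1 i) iA (cardD1 j) !inE eq_sym ij jA.
have A0 : #|A|%:R * (#|A|%:R - 1) != 0 :> R.
  rewrite mulf_neq0// ?subr_eq0 ?pnatr_eq0 -?lt0n ?(ltnW A2)//.
  by rewrite (eqr_nat _ _ 1) gtn_eqF.
pose c k l := \sum_(p in Sym A) f (p k) * f (p l).
have cC k l : c k l = c l k by apply: eq_bigr => p _; rewrite mulrC.
(* By left translation by a transposition, [c k l] is the same for all pairs
   of distinct points. *)
have cl k l l' : k \in A -> l \in A -> l' \in A -> l != k -> l' != k ->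
    c k l = c k l'.
  move=> kA lA l'A lk l'k; rewrite /c.
  rewrite (perm_sum_reindex (fun p => f (p k) * f (p l)) (tperm_Sym lA l'A)).
  by apply: eq_bigr => p _; rewrite !permM tpermL tpermD.
have cij k l : k \in A -> l \in A -> l != k -> c k l = c i j.
  move=> kA lA lk; have [ki|ki] := eqVneq k i.
    by rewrite ki in lk *; apply: cl; rewrite // eq_sym.
  by rewrite (cl k l i)// 1?eq_sym// cC; apply: cl; rewrite // eq_sym.
have e1 (g : 'I_n -> R) : (\sum_(k in A) g k) ^+ 2 - \sum_(k in A) g k ^+ 2
    = \sum_(k in A) \sum_(l in A | l != k) g k * g l.
  rewrite expr2 mulr_suml -sumrB; apply: eq_bigr => k kA.
  by rewrite mulr_sumr (bigD1 k)//= addrC -expr2 addrK.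
have : \sum_(k in A) \sum_(l in A | l != k) c k l
     = (#|A|%:R * (#|A|%:R - 1)) * c i j.
  transitivity (\sum_(k in A) (#|A|%:R - 1) * c i j); last first.
    by rewrite sumr_const -[LHS]mulr_natl mulrA.
  apply: eq_bigr => k kA.
  under eq_bigr => l /andP[lA lk] do rewrite (cij k l)//.
  rewrite sumr_const -[LHS]mulr_natl; congr (_ * _).
  rewrite [in RHS](cardD1 k) kA natrD addrC addKr; congr (_%:R).
  by apply: eq_card => l; rewrite !inE andbC.
have -> : \sum_(k in A) \sum_(l in A | l != k) c k l
    = \sum_(p in Sym A) ((\sum_(k in A) f k) ^+ 2 - \sum_(k in A) f k ^+ 2).
  under eq_bigr => k kA do rewrite exchange_big/=.
  rewrite exchange_big/=; apply: eq_bigr => p pA.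
  rewrite -(sum_perm_image f pA) -(sum_perm_image (fun k => f k ^+ 2) pA).
  exact/esym/(e1 (f \o p)).
rewrite sumr_const -[X in X = _]mulr_natl => e.
by apply/eqP; rewrite eqr_div// [eqbLHS]mulrC -e [eqbLHS]mulrC.
Qed.

End PermSum.
(** * The random states of the blocks *)

Section BlockStates.
Context (R : realFieldType) (n S : nat) (b : 'I_n -> 'I_S) (c : 'I_S -> R).

(** The indices [0, n) are grouped into blocks by [b]. *)
Definition block (s : 'I_S) : {set 'I_n} := finset (fun i => b i == s).

(** The members of the joint mix of block s, indexed by the elements p of the
    block. *)
Definition mix_map (s : 'I_S) (p : 'I_n) (u : R) : R :=
  joint_mix #|block s| (index p (enum (block s))) u.

(** The state of a block is [None] (all components are equal) or a permutation
    of the block.  Permutations of all the indices are used in order to have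
    the same type of states for all blocks; those not supported by the block
    get weight 0. *)
Definition state_weight (s : 'I_S) (a : option 'S_n) : R :=
  if a is Some p then
    if p \in Sym (block s) then (1 - c s) / #|Sym (block s)|%:R else 0
  else c s.

(** The component i as a function of the uniform variable of its block, when
    the block is in state [a]. *)
Definition state_map (i : 'I_n) (a : option 'S_n) (u : R) : R :=
  if a is Some p then mix_map (b i) (p i) u else u.

Lemma mem_block i : i \in block (b i).
Proof. by rewrite inE. Qed.

Lemma sum_mix_map s u : (2 <= #|block s|)%N ->
  \sum_(p in block s) mix_map s p u = #|block s|%:R / 2.
Proof.
move=> N2; rewrite -(sum_joint_mix u N2) -big_enum/=.
have [p0 _] : exists p, p \in block s.
  by apply/card_gt0P; rewrite (leq_trans _ N2).
rewrite (big_nth p0) -cardE big_mkord; apply: eq_bigr => r _.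
by rewrite /mix_map index_uniq ?enum_uniq// -cardE.
Qed.

Lemma sum_option (T : finType) (F : option T -> R) :
  \sum_a F a = F None + \sum_p F (Some p).
Proof.
rewrite (bigD1 None)//=; congr (_ + _).
rewrite (reindex_omap Some id)/=; last by case.
by apply: eq_bigl => p; rewrite eqxx.
Qed.

Lemma sum_state_weight s (F : option 'S_n -> R) :
  \sum_a state_weight s a * F a = c s * F None
    + (1 - c s) * (\sum_(p in Sym (block s)) F (Some p) / #|Sym (block s)|%:R).
Proof.
rewrite sum_option /=; congr (_ + _).
rewrite mulr_sumr [RHS]big_mkcond/=; apply: eq_bigr => p _.
by case: ifP => _; rewrite ?mul0r// mulrAC mulrA.
Qed.

Lemma state_weight_ge0 s a : 0 <= c s <= 1 -> 0 <= state_weight s a.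
Proof.
case/andP=> c0 c1; case: a => [p|]//=; case: ifP => // _.
by rewrite divr_ge0// subr_ge0.
Qed.

Lemma sum_state_weight1 s : \sum_a state_weight s a = 1.
Proof.
under eq_bigr do rewrite -[state_weight _ _]mulr1.
rewrite sum_state_weight -mulr_suml sumr_const divff; first by lra.
exact/lt0r_neq0/card_Sym_gt0.
Qed.

Lemma card_block_gt1 i : #|block (b i)| != 1%N -> (2 <= #|block (b i)|)%N.
Proof.
by move=> N1; rewrite ltn_neqAle eq_sym N1; apply/card_gt0P; exists i;
  exact: mem_block.
Qed.

Lemma mean_state_map i u : (#|block (b i)| = 1%N -> c (b i) = 1) ->
  \sum_a state_weight (b i) a * state_map i a u
  = c (b i) * u + (1 - c (b i)) / 2.
Proof.
move=> c1; rewrite sum_state_weight; congr (_ + _).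
have [/c1 ->|N1] := eqVneq #|block (b i)| 1%N; first by rewrite subrr !mul0r.
congr (_ * _); rewrite -mulr_suml /state_map.
have N2 := card_block_gt1 N1.
rewrite (mean_Sym (fun p => mix_map (b i) p u) (mem_block i)) sum_mix_map//.
by field; rewrite pnatr_eq0 -lt0n ltnW.
Qed.

Lemma mean_state_map2 i j u : b i = b j -> i != j ->
  \sum_a state_weight (b i) a * (state_map i a u * state_map j a u)
  = c (b i) * u ^+ 2 + (1 - c (b i)) *
     (((#|block (b i)|%:R / 2) ^+ 2
        - \sum_(p in block (b i)) mix_map (b i) p u ^+ 2)
      / (#|block (b i)|%:R * (#|block (b i)|%:R - 1))).
Proof.
move=> bij ij; rewrite sum_state_weight -expr2; congr (_ + _ * _).
have jA : j \in block (b i) by rewrite bij mem_block.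
rewrite -mulr_suml /state_map -bij.
rewrite (mean_Sym2 (fun p => mix_map (b i) p u) (mem_block i) jA ij).
rewrite sum_mix_map//.
by rewrite (cardD1 i) mem_block (cardD1 j) !inE eq_sym ij bij eqxx.
Qed.

(** The states of the blocks are independent. *)
Definition states_weight (k : {ffun 'I_S -> option 'S_n}) : R :=
  \prod_s state_weight s (k s).

Lemma states_weight_ge0 k : (forall s, 0 <= c s <= 1) -> 0 <= states_weight k.
Proof. by move=> c01; apply: prodr_ge0 => s _; exact: state_weight_ge0. Qed.

Lemma sum_states_weight (h : 'I_S -> option 'S_n -> R) :
  \sum_k states_weight k * \prod_s h s (k s)
  = \prod_s \sum_a state_weight s a * h s a.
Proof.
rewrite bigA_distr_bigA/=; apply: eq_bigr => k _.
by rewrite -big_split.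
Qed.

Lemma sum_states_weight0 : \sum_k states_weight k = 1.
Proof.
have /= := sum_states_weight (fun _ _ => 1).
under eq_bigr do rewrite big1_eq mulr1.
move=> ->; apply: big1 => s _; under eq_bigr do rewrite mulr1.
exact: sum_state_weight1.
Qed.

Lemma sum_states_weight1 s (h : option 'S_n -> R) :
  \sum_k states_weight k * h (k s) = \sum_a state_weight s a * h a.
Proof.
have /= := sum_states_weight (fun s' a => if s' == s then h a else 1).
under eq_bigr => k _ do rewrite -big_mkcond/= big_pred1_eq.
move=> ->; rewrite (bigD1 s)//= eqxx [X in _ * X]big1 ?mulr1// => s' /negbTE ->.
by under eq_bigr do rewrite mulr1; exact: sum_state_weight1.
Qed.

Lemma sum_states_weight2 s t (g h : option 'S_n -> R) : s != t ->
  \sum_k states_weight k * (g (k s) * h (k t))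
  = (\sum_a state_weight s a * g a) * (\sum_a state_weight t a * h a).
Proof.
move=> st.
have /= := sum_states_weight
  (fun s' a => if s' == s then g a else if s' == t then h a else 1).
under eq_bigr => k _.
  rewrite (bigD1 s)//= eqxx (bigD1 t)/=; last by rewrite eq_sym.
  rewrite eq_sym (negbTE st) eqxx big1 ?mulr1; last first.
    by move=> s' /andP[/negbTE -> /negbTE ->].
  over.
move=> ->; rewrite (bigD1 s)//= eqxx (bigD1 t)/=; last by rewrite eq_sym.
rewrite eq_sym (negbTE st) eqxx [X in _ * (_ * X)]big1 ?mulr1//.
move=> s' /andP[/negbTE -> /negbTE ->].
by under eq_bigr do rewrite mulr1; exact: sum_state_weight1.
Qed.

End BlockStates.
(** * Uniform random variables *)

Section MeasureOnLine.
Context (R : realType).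
Local Open Scope ereal_scope.

Lemma eq_measure_rays (m1 m2 : {measure set (measurableTypeR R) -> \bar R}) :
  m1 setT < +oo ->
  (forall x : R, m1 `]-oo, x]%classic = m2 `]-oo, x]%classic) ->
  forall A, measurable A -> m1 A = m2 A.
Proof.
move=> m1fin m12; have rayfin x : m1 `]-oo, x]%classic < +oo.
  by apply: le_lt_trans m1fin; rewrite le_measure ?inE.
have rayfin2 x : m2 `]-oo, x]%classic < +oo by rewrite -m12.
have ocE (a b : R) : (a <= b)%R -> `]a, b]%classic = `]-oo, b] `\` `]-oo, a].
  move=> ab.
  by rewrite -[RHS]setCK setCD setCitvl setUC -[LHS]setCK setCitv.
move=> A mA.
refine (@g_sigma_algebra_measure_unique _ R (measurableTypeR R) (@ocitv R) _
  (fun k => `](- k%:R)%R, k%:R]%classic) _ _ m1 m2 _ _ _ A mA) => //.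
- by move=> _ [[a b] _ <-]; exact: measurable_itv.
- by move=> k; exact: is_ocitv.
- rewrite -subTset => x _; exists (Num.bound `|x|) => //=.
  have := archi_boundP (normr_ge0 x).
  by rewrite ltr_norml in_itv/= => /andP[-> /ltW].
- exact: ocitvI.
- move=> _ [[a b] _ <-] /=; have [ab|ba] := leP a b; last first.
    by rewrite set_itv_ge ?measure0// bnd_simp -leNgt ltW.
  have sub : `]-oo, a]%classic `<=` `]-oo, b]%classic by exact: subset_itvl.
  rewrite ocE// !measureD//; [|exact: rayfin2|exact: rayfin].
  by rewrite setIidr//; congr (_ - _); exact: m12.
- by move=> k; apply: le_lt_trans m1fin; rewrite le_measure ?inE.
Qed.

End MeasureOnLine.

Section UniformVariables.
Context (disp : measure_display) (T : measurableType disp) (R : realType)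
  (Pr : probability T R).
Local Open Scope ereal_scope.

Definition mkRV (f : T -> R) (mf : measurable_fun setT f) : {RV Pr >-> R} :=
  mfun_Sub (mem_set mf).

Lemma mkRVE (f : T -> R) (mf : measurable_fun setT f) : mkRV mf = f :> (T -> R).
Proof. exact: mfun_valP. Qed.

(** V is uniform on [0, 1]; its values are required to lie in [0, 1]
    everywhere, so that the distribution function of V evaluated at V is V. *)
Definition is_uniform (V : {RV Pr >-> R}) : Prop :=
  (forall t, (0 <= V t <= 1)%R) /\
  (forall x : R, (0 <= x <= 1)%R -> Pr (V @^-1` `]-oo, x]) = x%:E).

Lemma measurable_df (X : {RV Pr >-> R}) :
  measurable_fun setT (fun t => df X (X t)).
Proof.
apply: (@measurableT_comp _ _ _ _ _ _ (df X)) => //.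
apply/measurable_EFinP; apply: eq_measurable_fun (cdf_measurable X) => r _ /=.
by rewrite /df fineK// fin_num_measure.
Qed.

Lemma df_itv01 (X : {RV Pr >-> R}) x : (0 <= df X x <= 1)%R.
Proof.
rewrite /df -!lee_fin fineK ?fin_num_measure// cdf_ge0 cdf_le1//.
Qed.

Lemma df_nondecreasing (X : {RV Pr >-> R}) : {homo df X : x y / (x <= y)%R}.
Proof.
by move=> x y xy; rewrite /df fine_le ?fin_num_measure// cdf_nondecreasing.
Qed.

Lemma dfE (X : {RV Pr >-> R}) x : Pr (X @^-1` `]-oo, x]) = (df X x)%:E.
Proof. by rewrite /df fineK// fin_num_measure. Qed.

Lemma df_surjective (X : {RV Pr >-> R}) x : continuous (df X) ->
  (0 < x < 1)%R -> exists q, df X q = x.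
Proof.
move=> cX /andP[x0 x1].
have cy : df X r @[r --> +oo%R] --> (1%R : R) by exact/fine_cvg/cvg_cdfy1.
have cNy : df X r @[r --> -oo%R] --> (0%R : R) by exact/fine_cvg/cvg_cdfNy0.
have [b /ltW xb] := filter_ex (cvgr_gt _ cy _ x1).
have [a ax] := filter_ex (cvgr_lt _ cNy _ x0).
have ab : (a <= b)%R.
  rewrite leNgt; apply/negP => /ltW ba.
  have := lt_le_trans (le_lt_trans (df_nondecreasing X ba) ax) xb.
  by rewrite ltxx.
have [||q _ <-] := @IVT R (df X) a b x ab; [| |by exists q].
  exact: continuous_subspaceT.
by rewrite ge_min (ltW ax) le_max xb orbT.
Qed.

(** Probability integral transform. *)
Lemma is_uniform_df (X : {RV Pr >-> R}) : continuous (df X) ->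
  is_uniform (mkRV (measurable_df X)).
Proof.
move=> cX; split => [t|x /andP[x0 x1]]; rewrite mkRVE; first exact: df_itv01.
have mU := measurable_df X.
have mE : measurable ((fun t => df X (X t)) @^-1` `]-oo, x]).
  by rewrite -[X in measurable X]setTI; exact: mU.
have mX q : measurable (X @^-1` `]-oo, q]) by exact: measurable_funPTI.
apply/eqP; rewrite eq_le; apply/andP; split.
(* If F(q) = x + e, then F(X) <= x implies X <= q. *)
- apply/lee_addgt0Pr => e e0.
  have [xe1|xe1] := leP 1%R (x + e)%R.
    by rewrite (le_trans (probability_le1 _ mE))// lee_fin.
  have [|q qE] := @df_surjective X (x + e)%R cX.
    by rewrite xe1 andbT ltr_wpDl.
  rewrite -EFinD -qE -dfE le_measure ?inE//.
  move=> t /=; rewrite !in_itv/= => Xx; rewrite leNgt; apply/negP => /ltW qX.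
  have := le_trans (df_nondecreasing X qX) Xx.
  by rewrite qE leNgt ltrDl e0.
- have [->//|xn0] := eqVneq x 0%R.
  (* The value 1 need not be attained by the distribution function. *)
  have [x_1|xn1] := eqVneq x 1%R.
    rewrite x_1 (_ : _ @^-1` _ = setT) ?probability_setT//.
    apply/seteqP; split => // t _ /=; rewrite in_itv/=.
    by have /andP[] := df_itv01 X (X t).
  have [|q qE] := @df_surjective X x cX.
    by rewrite lt_neqAle eq_sym xn0 x0 lt_neqAle xn1.
  rewrite -[in leLHS]qE -dfE le_measure ?inE//.
  move=> t /=; rewrite !in_itv/= => Xq.
  by rewrite -qE df_nondecreasing.
Qed.

End UniformVariables.
Section UniformLaw.
Context (R : realType).
Local Notation mu := (@lebesgue_measure R).
Local Notation unif := (uniform_prob (@ltr01 R)).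
Local Open Scope ereal_scope.

Lemma uniform_probE (A : set R) : measurable A ->
  unif A = mu (A `&` `[0%R, 1%R]).
Proof.
move=> mA; rewrite /uniform_prob integral_uniform_pdf.
rewrite (eq_integral (cst 1%:E)).
  by rewrite integral_cst ?mul1e//; exact: measurableI.
move=> x /[!inE] -[_]; rewrite /= in_itv/= /uniform_pdf => ->.
by rewrite subr0 invr1.
Qed.

Lemma uniform_prob_ray (x : R) : (0 <= x <= 1)%R ->
  unif `]-oo, x]%classic = x%:E.
Proof.
move=> /andP[x0 x1]; rewrite uniform_probE//.
have -> : `]-oo, x] `&` `[0%R, 1%R] = `[0%R, x]%classic.
  apply/seteqP; split => y /=; rewrite !in_itv/=.
    by move=> [-> /andP[-> _]].
  by move=> /andP[-> yx]; rewrite yx (le_trans yx).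
rewrite lebesgue_measure_itv/= lte_fin -EFinB subr0.
by have [//|] := ltP 0%R x; rewrite le_eqVlt ltNge x0 orbF => /eqP ->.
Qed.

Lemma uniform_prob_ray_lt0 (x : R) : (x < 0)%R -> unif `]-oo, x]%classic = 0.
Proof.
move=> x0; rewrite uniform_probE// (_ : _ `&` _ = set0) ?measure0//.
apply/seteqP; split => // t [] /=; rewrite !in_itv/= => /le_lt_trans/(_ x0).
by rewrite ltNge => /negbTE ->.
Qed.

Lemma uniform_prob_ray_gt1 (x : R) : (1 < x)%R -> unif `]-oo, x]%classic = 1.
Proof.
move=> x1; rewrite uniform_probE// (_ : _ `&` _ = `[0%R, 1%R]%classic).
  by rewrite lebesgue_measure_itv/= lte_fin ltr01 -EFinB subr0.
apply/setIidr => t /=; rewrite !in_itv/= => /andP[_ /le_trans]; apply.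
exact: ltW.
Qed.

Lemma integral_itv01_exp n :
  \int[mu]_(u in `[0%R, 1%R]) (u ^+ n)%:E = (n.+1%:R^-1)%:E.
Proof.
have cX (m : nat) : continuous (fun u : R => u ^+ m)%R.
  by move=> u; exact: exprn_continuous.
rewrite (@continuous_FTC2 _ _ (fun u : R => u ^+ n.+1 / n.+1%:R)%R)//.
- by rewrite expr1n expr0n/= mul0r mul1r sube0.
- exact: continuous_subspaceT.
- split.
  + by move=> u _; apply: derivableM => //; exact: exprn_derivable.
  + by apply: cvg_at_right_filter; apply: cvgM; [exact: cX|exact: cvg_cst].
  + by apply: cvg_at_left_filter; apply: cvgM; [exact: cX|exact: cvg_cst].
- move=> u _; rewrite derive1Mr//; last exact: exprn_derivable.
  by rewrite derive1E exp_derive /= scaler1 mulrAC divff// mul1r.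
Qed.

End UniformLaw.

Section UniformVariable.
Context (disp : measure_display) (T : measurableType disp) (R : realType)
  (Pr : probability T R).
Local Notation unif := (uniform_prob (@ltr01 R)).
Local Open Scope ereal_scope.

Lemma law_is_uniform (V : {RV Pr >-> R}) : is_uniform V ->
  forall A : set R, measurable A -> Pr (V @^-1` A) = unif A.
Proof.
move=> [V01 VE].
(* The uniform law is a measure on [measurableTypeR R], a structure distinct
   from R with the same measurable sets. *)
have mV : measurable_fun setT (V : T -> measurableTypeR R).
  exact: (measurable_funP V).
pose W : {mfun T >-> measurableTypeR R} :=
  HB.pack (V : T -> measurableTypeR R) (isMeasurableFun.Build _ _ _ _ _ mV).
suff UW A : measurable A -> distribution Pr W A = unif A.
  by move=> A mA; exact: UW.
move: A; refine (@eq_measure_rays R (distribution Pr W) unif _ _).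
  by rewrite /= /distribution /pushforward preimage_setT probability_setT ltry.
move=> x; change (Pr (V @^-1` `]-oo, x]) = unif `]-oo, x]%classic).
have [x0|x0] := ltP x 0%R.
  rewrite (_ : _ @^-1` _ = set0) ?measure0.
    exact: (esym (uniform_prob_ray_lt0 x0)).
  apply/seteqP; split => // t /=; rewrite in_itv/= leNgt.
  by have /andP[/(lt_le_trans x0) ->] := V01 t.
have [x1|x1] := leP x 1%R.
  by rewrite VE ?x0//; apply/esym/uniform_prob_ray; rewrite x0.
rewrite (_ : _ @^-1` _ = setT) ?probability_setT.
  exact: (esym (uniform_prob_ray_gt1 x1)).
apply/seteqP; split => // t _ /=; rewrite in_itv/=.
by have /andP[_ /le_trans] := V01 t; apply; exact: ltW.
Qed.

(** g maps [0, 1] to itself and preserves the uniform law. *)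
Definition preserves_uniform (g : R -> R) : Prop :=
  [/\ measurable_fun setT g,
      (forall u, 0 <= u <= 1 -> 0 <= g u <= 1)%R
    & (forall x, (0 <= x <= 1)%R -> unif (g @^-1` `]-oo, x]) = x%:E)].

Lemma is_uniform_comp (V W : {RV Pr >-> R}) (g : R -> R) :
  preserves_uniform g -> is_uniform V -> W = g \o V :> (T -> R) ->
  is_uniform W.
Proof.
move=> [mg g01 gE] UV WE; split => [t|x x01].
  by rewrite WE g01//; exact: UV.1.
rewrite WE comp_preimage -gE// -(law_is_uniform UV)//.
by rewrite -[X in measurable X]setTI; exact: mg.
Qed.

Lemma ge0_expectation_uniform (V : {RV Pr >-> R}) (f : R -> R) :
  is_uniform V -> measurable_fun setT f -> (forall u, 0 <= f u)%R ->
  'E_Pr[f \o V] = \int[lebesgue_measure]_(u in `[0%R, 1%R]) (f u)%:E.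
Proof.
move=> UV mf f0.
have mf' : measurable_fun setT (EFin \o f) by exact/measurable_EFinP.
have mV : measurable_fun setT (V : T -> measurableTypeR R).
  exact: (measurable_funP V).
pose W : {mfun T >-> measurableTypeR R} :=
  HB.pack (V : T -> measurableTypeR R) (isMeasurableFun.Build _ _ _ _ _ mV).
have WE : \int[distribution Pr W]_u (EFin \o f) u = 'E_Pr[f \o V].
  by rewrite unlock; exact: (ge0_integral_distribution W mf' _).
rewrite -{}WE (eq_measure_integral unif); last first.
  by move=> A mA _; exact: law_is_uniform.
by rewrite integral_uniform// subr0 invr1 mul1e.
Qed.

Lemma expectation_uniform_exp (V : {RV Pr >-> R}) n : is_uniform V ->
  'E_Pr[fun t => V t ^+ n]%R = (n.+1%:R^-1)%:E.
Proof.
move=> UV; pose f (u : R) : R := (`|u| ^+ n)%R.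
have -> : (fun t => V t ^+ n)%R = f \o V.
  apply/funext => t; rewrite /f /= ger0_norm//.
  by have /andP[] := UV.1 t.
rewrite ge0_expectation_uniform//.
- rewrite -integral_itv01_exp; apply: eq_integral => u /[!inE] /=.
  by rewrite in_itv/= /f => /andP[u0 _]; rewrite ger0_norm.
- by apply: measurable_funX; exact: normr_measurable.
- by move=> u; rewrite exprn_ge0.
Qed.

End UniformVariable.
Section PreservesUniform.
Context (R : realType).
Local Notation mu := (@lebesgue_measure R).
Local Notation unif := (uniform_prob (@ltr01 R)).

(** The uniform measure of A is computed on each of the half-intervals
    [0, 1 / 2) and [1 / 2, 1], on which the maps of the triple are affine. *)
Lemma uniform_prob_halves (A B C : set R) (x y : R) :
  measurable A ->
  A `&` `[0, 1 / 2[ = B -> A `&` `[1 / 2, 1] = C ->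
  mu B = x%:E -> mu C = y%:E -> unif A = (x + y)%:E.
Proof.
move=> mA AB AC mB mC; rewrite uniform_probE//.
have -> : `[0, 1]%classic = `[0, 1 / 2[ `|` `[1 / 2, 1] :> set R.
  apply/seteqP; split => u /=; rewrite !in_itv/=.
    move=> /andP[u0 u1]; rewrite u0 u1 andbT.
    by have [?|?] := ltP u (1 / 2); [left|right].
  by move=> [/andP[]|/andP[]] ? ?; apply/andP; split; lra.
rewrite setIUr AB AC EFinD -mB -mC; apply: measureU.
- by rewrite -AB; exact: measurableI.
- by rewrite -AC; exact: measurableI.
- rewrite -AB -AC -subset0 => u [[_ hu] [_ hu']] /=; move: hu hu'.
  by rewrite /= !in_itv/= => /andP[_]; rewrite ltNge => /negP hu /andP[/hu].
Qed.

Lemma preserves_uniform_id : preserves_uniform (@id R).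
Proof.
split => // x x01.
by rewrite preimage_id uniform_prob_ray.
Qed.

Lemma measurable_shift_half : measurable_fun setT (@shift_half R).
Proof.
apply: measurable_fun_if => //=.
- exact: measurable_fun_ltr.
- by apply: measurable_funTS; apply: measurable_funD.
- by apply: measurable_funTS; apply: measurable_funB.
Qed.

Lemma preserves_uniform_flip : preserves_uniform (fun u : R => 1 - u).
Proof.
have mf : measurable_fun setT (fun u : R => 1 - u) by exact: measurable_funB.
split => // [u|x /andP[x0 x1]]; first by lra.
rewrite uniform_probE; last by rewrite -[X in measurable X]setTI; exact: mf.
rewrite (_ : _ `&` _ = `[1 - x, 1]%classic); last first.
  apply/seteqP; split => u /=; rewrite !in_itv/=.
    by move=> [? /andP[? ?]]; apply/andP; split; lra.
  by move=> /andP[? ?]; split; [|apply/andP; split]; lra.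
rewrite lebesgue_measure_itv/= lte_fin -EFinB.
by case: ltP => h; congr (_%:E); lra.
Qed.

Lemma lebesgue_measure_bnd (a b : R) (p q : bool) : a <= b ->
  mu [set` Interval (BSide p a) (BSide q b)] = (b - a)%:E.
Proof.
move=> ab; rewrite lebesgue_measure_itv/= lte_fin -EFinB.
by case: ltP => // ba; congr (_%:E); lra.
Qed.

Lemma preserves_uniform_shift_half : preserves_uniform (@shift_half R).
Proof.
split => [|u|x /andP[x0 x1]]; first exact: measurable_shift_half.
  by rewrite /shift_half; case: ltP; lra.
have mA : measurable (@shift_half R @^-1` `]-oo, x]).
  by rewrite -[X in measurable X]setTI; exact: measurable_shift_half.
have [xh|xh] := ltP x (1 / 2).
- rewrite -[x in RHS]add0r.
  apply: (@uniform_prob_halves _ set0 `[1 / 2, x + 1 / 2]%classic) => //.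
  + apply/seteqP; split => // u [] /=; rewrite !in_itv/= /shift_half.
    by case: ltP => ? ? /andP[? ?]; lra.
  + apply/seteqP; split => u /=; rewrite !in_itv/= /shift_half.
      by move=> [+ /andP[? ?]]; case: ltP => ? ?; apply/andP; split; lra.
    by move=> /andP[? ?]; case: ltP => ?; split; try (apply/andP; split); lra.
  + exact: measure0.
  + by etransitivity; [apply: lebesgue_measure_bnd | congr (_%:E)]; lra.
- rewrite [x in RHS](_ : x = (x - 1 / 2) + 1 / 2); last by lra.
  apply: (@uniform_prob_halves _
    [set` Interval (BLeft 0) (BSide (x == 1) (x - 1 / 2))]
    `[1 / 2, 1]%classic) => //.
  + apply/seteqP; split => u /=; rewrite !in_itv/= /shift_half.
      move=> [+ /andP[? ?]]; case: ltP => ? ?; last by lra.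
      by case: (eqVneq x 1) => /= [->|?]; apply/andP; split; lra.
    case: (eqVneq x 1) => /= [->|x1'] /andP[? ?]; case: ltP => ?; split;
      try (apply/andP; split); try lra.
  + apply/seteqP; split => u /=; rewrite !in_itv/= /shift_half.
      by move=> [].
    by move=> /andP[? ?]; case: ltP => ?; split; try (apply/andP; split); lra.
  + by etransitivity; [apply: lebesgue_measure_bnd | congr (_%:E)]; lra.
  + by etransitivity; [apply: lebesgue_measure_bnd | congr (_%:E)]; lra.
Qed.

Lemma preserves_uniform_triple_rest : preserves_uniform (@triple_rest R).
Proof.
have mf : measurable_fun setT (@triple_rest R).
  apply: measurable_funB; first exact: measurable_funB.
  exact: measurable_shift_half.
split => // [u|x /andP[x0 x1]].
  by rewrite /triple_rest /shift_half; case: ltP; lra.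
rewrite [x in RHS](_ : x = x / 2 + x / 2); last by lra.
apply: (@uniform_prob_halves _ `[(1 - x) / 2, 1 / 2[%classic
  `[1 - x / 2, 1]%classic).
- by rewrite -[X in measurable X]setTI; exact: mf.
- apply/seteqP; split => u /=; rewrite !in_itv/= /triple_rest /shift_half.
    by move=> [+ /andP[? ?]]; case: ltP => ? ?; apply/andP; split; lra.
  by move=> /andP[? ?]; case: ltP => ?; split; try (apply/andP; split); lra.
- apply/seteqP; split => u /=; rewrite !in_itv/= /triple_rest /shift_half.
    by move=> [+ /andP[? ?]]; case: ltP => ? ?; apply/andP; split; lra.
  by move=> /andP[? ?]; case: ltP => ?; split; try (apply/andP; split); lra.
- by etransitivity; [apply: lebesgue_measure_bnd | congr (_%:E)]; lra.
- by etransitivity; [apply: lebesgue_measure_bnd | congr (_%:E)]; lra.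
Qed.

Lemma preserves_uniform_joint_mix N r : preserves_uniform (@joint_mix R N r).
Proof.
rewrite /joint_mix; case: (odd N && (r < 3)%N).
  case: r => [|[|r]].
  - exact: preserves_uniform_id.
  - exact: preserves_uniform_shift_half.
  - exact: preserves_uniform_triple_rest.
by case: (odd r); [exact: preserves_uniform_flip|exact: preserves_uniform_id].
Qed.

End PreservesUniform.
(** * Spearman's rho of uniform variables *)

Section Moments.
Context (disp : measure_display) (T : measurableType disp) (R : realType)
  (Pr : probability T R).
Local Open Scope ereal_scope.

(** The expectation as a real number. *)
Definition mean (f : T -> R) : R := fine 'E_Pr[f].

Lemma bounded_Lfun1 (f : T -> R) (M : R) : measurable_fun setT f ->
  (forall t, (`|f t| <= M)%R) -> f \in Lfun Pr 1.
Proof.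
move=> mf fM; apply/Lfun1_integrable.
apply: measurable_bounded_integrable => //.
  exact: (le_lt_trans (probability_le1 Pr measurableT) (ltry _)).
exists M; split; first exact: num_real.
by move=> x Mx t _; exact: le_trans (fM t) (ltW Mx).
Qed.

Lemma meanE (f : T -> R) : f \in Lfun Pr 1 -> 'E_Pr[f] = (mean f)%:E.
Proof. by move=> lf; rewrite /mean fineK// expectation_fin_num. Qed.

Lemma mean_cst (a : R) : mean (fun=> a) = a.
Proof. by rewrite /mean (expectation_cst Pr a). Qed.

Lemma Lfun1_cst (a : R) : (fun=> a) \in Lfun Pr 1.
Proof. by apply: (@bounded_Lfun1 _ `|a|%R). Qed.

Lemma Lfun1D (f g : T -> R) : f \in Lfun Pr 1 -> g \in Lfun Pr 1 ->
  (fun t => f t + g t)%R \in Lfun Pr 1.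
Proof. by move=> lf lg; exact: rpredD. Qed.

Lemma Lfun1Z (a : R) (f : T -> R) : f \in Lfun Pr 1 ->
  (fun t => a * f t)%R \in Lfun Pr 1.
Proof.
move=> lf; rewrite (_ : (fun _ => _) = (a \o* f)%R); first exact: Lfun_scale.
by apply/funext => t /=; rewrite mulrC.
Qed.

Lemma Lfun1_sum (I : Type) (r : seq I) (P : pred I) (f : I -> T -> R) :
  (forall i, P i -> f i \in Lfun Pr 1) ->
  (fun t => \sum_(i <- r | P i) f i t)%R \in Lfun Pr 1.
Proof.
move=> lf; rewrite (_ : (fun _ => _) = (\sum_(i <- r | P i) f i)%R).
  exact: rpred_sum.
by apply/funext => t; rewrite fct_sumE.
Qed.

Lemma meanD (f g : T -> R) : f \in Lfun Pr 1 -> g \in Lfun Pr 1 ->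
  mean (fun t => f t + g t)%R = (mean f + mean g)%R.
Proof.
move=> lf lg; rewrite {1}/mean (_ : (fun _ => _) = f \+ g)%R//.
by rewrite expectationD// !meanE.
Qed.

Lemma meanZ (a : R) (f : T -> R) : f \in Lfun Pr 1 ->
  mean (fun t => a * f t)%R = (a * mean f)%R.
Proof.
move=> lf; rewrite {1}/mean (_ : (fun _ => _) = a \o* f)%R; last first.
  by apply/funext => t /=; rewrite mulrC.
by rewrite expectationZl// meanE.
Qed.

Lemma mean_sum (I : Type) (r : seq I) (P : pred I) (f : I -> T -> R) :
  (forall i, P i -> f i \in Lfun Pr 1) ->
  mean (fun t => \sum_(i <- r | P i) f i t)%R
  = (\sum_(i <- r | P i) mean (f i))%R.
Proof.
move=> lf; elim: r => [|i r IHr].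
  rewrite big_nil -[RHS](mean_cst 0%R).
  by congr mean; apply/funext => t; rewrite big_nil.
rewrite big_cons; case: ifPn => Pi.
  rewrite -IHr -meanD//; [|exact: lf|exact: Lfun1_sum].
  by congr mean; apply/funext => t; rewrite big_cons Pi.
by rewrite -IHr; congr mean; apply/funext => t; rewrite big_cons (negbTE Pi).
Qed.

Lemma Lfun1_uniform (U : {RV Pr >-> R}) : is_uniform U ->
  (U : T -> R) \in Lfun Pr 1.
Proof.
move=> UU; apply: (@bounded_Lfun1 _ 1%R) => // t.
by have /andP[? ?] := UU.1 t; rewrite ger0_norm.
Qed.

Lemma Lfun1_uniformM (U V : {RV Pr >-> R}) : is_uniform U -> is_uniform V ->
  (fun t => U t * V t)%R \in Lfun Pr 1.
Proof.
move=> UU UV; apply: (@bounded_Lfun1 _ 1%R) => [|t].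
  exact: measurable_funM.
have /andP[? ?] := UU.1 t; have /andP[? ?] := UV.1 t.
by rewrite ger0_norm ?mulr_ge0// mulr_ile1.
Qed.

Lemma mean_uniform (U : {RV Pr >-> R}) : is_uniform U -> mean U = (1 / 2)%R.
Proof.
move=> UU; have := expectation_uniform_exp 1 UU.
rewrite (_ : (fun _ => _) = U); last by apply/funext => t; rewrite expr1.
by rewrite /mean => -> /=; rewrite mul1r.
Qed.

Lemma mean_uniform_sqr (U : {RV Pr >-> R}) : is_uniform U ->
  mean (fun t => U t * U t)%R = (1 / 3)%R.
Proof.
move=> UU; have := expectation_uniform_exp 2 UU.
rewrite (_ : (fun _ => _) = (fun t => U t * U t)%R); last first.
  by apply/funext => t; rewrite expr2.
by rewrite /mean => -> /=; rewrite mul1r.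
Qed.

Lemma pearson_uniform (U V : {RV Pr >-> R}) : is_uniform U -> is_uniform V ->
  pearson Pr U V = (12 * mean (fun t => U t * V t) - 3)%R.
Proof.
move=> UU UV.
have covE (X Y : {RV Pr >-> R}) : is_uniform X -> is_uniform Y ->
    fine (covariance Pr X Y) = (mean (fun t => X t * Y t) - 1 / 4)%R.
  move=> UX UY; have lX := Lfun1_uniform UX; have lY := Lfun1_uniform UY.
  have lXY : ((X : T -> R) * (Y : T -> R))%R \in Lfun Pr 1.
    exact: Lfun1_uniformM.
  rewrite covarianceE// (meanE lX) (meanE lY) (meanE lXY).
  rewrite (mean_uniform UX) (mean_uniform UY) /=.
  by congr (_ - _)%R; lra.
have varE (W : {RV Pr >-> R}) : is_uniform W ->
    fine (variance Pr W) = (1 / 12)%R.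
  by move=> UW; rewrite /variance covE// mean_uniform_sqr//; lra.
rewrite /pearson covE// !varE// -expr2 sqr_sqrtr; last by lra.
by lra.
Qed.

Lemma df_uniform (U : {RV Pr >-> R}) : is_uniform U ->
  df U = (cst 0%R \max (id \min cst 1%R))%R.
Proof.
move=> UU; apply/funext => x; apply/EFin_inj; rewrite -dfE.
rewrite law_is_uniform//=.
have [x0|x0] := ltP x 0%R.
  rewrite uniform_prob_ray_lt0//; congr (_%:E); apply/esym/max_idPl.
  by rewrite ge_min (ltW x0).
have [x1|x1] := leP x 1%R.
  by rewrite uniform_prob_ray ?x0//; congr (_%:E); apply/esym/max_idPr.
by rewrite uniform_prob_ray_gt1//; congr (_%:E); apply/esym/max_idPr.
Qed.

Lemma continuous_df_uniform (U : {RV Pr >-> R}) : is_uniform U ->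
  continuous (df U).
Proof.
move=> UU; rewrite df_uniform// => x.
apply: continuous_max; first exact: cvg_cst.
by apply: continuous_min; [exact: cvg_id|exact: cvg_cst].
Qed.

Lemma spearman_uniform (U V : {RV Pr >-> R}) : is_uniform U -> is_uniform V ->
  spearman U V = (12 * mean (fun t => U t * V t) - 3)%R.
Proof.
move=> UU UV; rewrite -pearson_uniform//.
have dfU (X : {RV Pr >-> R}) : is_uniform X -> (fun t => df X (X t)) = X.
  move=> UX; apply/funext => t; rewrite df_uniform//=.
  have /andP[X0 X1] := UX.1 t.
  by rewrite (min_idPl X1); apply/max_idPr.
by rewrite /spearman !dfU.
Qed.

End Moments.
(** * Mixtures *)

(** The space (T', Pr') carries, for any finite probability w, an index of law
    w together with an independent copy of a point of (T, Pr): the index is k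
    on [I k], where the point is given by [phi k]. *)
Definition splits (disp disp' : measure_display) (T : measurableType disp)
    (T' : measurableType disp') (R : realType)
    (Pr : probability T R) (Pr' : probability T' R) : Prop :=
  forall (m : nat) (w : 'I_m -> R), (forall k, 0 <= w k) -> \sum_k w k = 1 ->
  exists (I : 'I_m -> set T') (phi : 'I_m -> T' -> T),
    [/\ forall k, measurable (I k), trivIset setT I,
        forall k, measurable_fun setT (phi k)
      & forall k A, measurable A ->
          Pr' (I k `&` phi k @^-1` A) = ((w k)%:E * Pr A)%E].

Section Mixture.
Context (disp disp' : measure_display) (T : measurableType disp)
  (T' : measurableType disp') (R : realType)
  (Pr : probability T R) (Pr' : probability T' R).
Context (m : nat) (w : 'I_m -> R) (I : 'I_m -> set T') (phi : 'I_m -> T' -> T).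
Hypotheses (w0 : forall k, 0 <= w k) (w1 : \sum_k w k = 1).
Hypotheses (mI : forall k, measurable (I k)) (tI : trivIset setT I).
Hypothesis mphi : forall k, measurable_fun setT (phi k).
Hypothesis Pphi : forall k A, measurable A ->
  Pr' (I k `&` phi k @^-1` A) = ((w k)%:E * Pr A)%E.
Local Open Scope ereal_scope.

(** The probability of an event of T' that coincides on [I k] with the event
    [A k] of T. *)
Lemma mixture_prob (A' : set T') (A : 'I_m -> set T) :
  measurable A' -> (forall k, measurable (A k)) ->
  (forall k, I k `&` A' = I k `&` phi k @^-1` A k) ->
  Pr' A' = \sum_k (w k)%:E * Pr (A k).
Proof.
move=> mA' mA AE; pose D := \big[setU/set0]_(k < m) I k.
have mD : measurable D by exact: bigsetU_measurable.
have PD : Pr' D = 1.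
  rewrite /D measure_semi_additive_ord//.
  rewrite (eq_bigr (fun k => (w k)%:E)) ?sumEFin ?w1// => k _.
  have := Pphi k measurableT.
  by rewrite preimage_setT setIT probability_setT mule1.
(* The sets I k cover T' up to a null set, as the weights add up to 1. *)
have PDC : Pr' (A' `\` D) = 0.
  apply/eqP; rewrite eq_le measure_ge0 andbT.
  rewrite -(subee (x := 1%E))// -{2}PD -probability_setC//.
  rewrite le_measure ?inE//;
    by do ?[exact: measurableD|exact: measurableC|exact: subDsetr].
have mIA k : measurable (A' `&` I k) by exact: measurableI.
rewrite (@measureDI _ _ _ Pr' A' D)// [X in X + _]PDC add0e /D big_distrr/=.
rewrite measure_semi_additive_ord//.
- by apply: eq_bigr => k _; rewrite setIC AE; exact: Pphi.
- exact: trivIset_setIl.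
- exact: bigsetU_measurable.
Qed.

(** Reduces to probabilities of events by the tail formula for expectations. *)
Lemma mixture_expectation (Z' : {RV Pr' >-> R}) (Z : 'I_m -> {RV Pr >-> R}) :
  (forall t, 0 <= Z' t)%R -> (forall k t, 0 <= Z k t)%R ->
  (forall k t, I k t -> Z' t = Z k (phi k t)) ->
  'E_Pr'[Z'] = \sum_k (w k)%:E * 'E_Pr[Z k].
Proof.
move=> Z'0 Z0 ZE; rewrite ge0_expectation_ccdf//.
under eq_bigr do rewrite ge0_expectation_ccdf//.
rewrite (eq_integral
  (fun r : measurableTypeR R => \sum_k (w k)%:E * ccdf (Z k) r)).
  rewrite ge0_integral_sum//.
  - apply: eq_bigr => k _; rewrite ge0_integralZl//; last by rewrite lee_fin.
    by apply: measurable_funTS; exact: ccdf_measurable.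
  - move=> k; apply: emeasurable_funM => //.
    by apply: measurable_funTS; exact: ccdf_measurable.
  - by move=> k r _; rewrite mule_ge0// lee_fin.
move=> r _; apply: mixture_prob => [|k|k].
- exact: measurable_funPTI.
- exact: measurable_funPTI.
- by apply/seteqP; split => t [It] /=; rewrite (ZE k)//.
Qed.

(** The variable equal to [V k] at the point [phi k] when the index is k; it is
    0 on the null set where there is no index. *)
Definition mixture (V : 'I_m -> T -> R) (t : T') : R :=
  (\sum_k \1_(I k) t * V k (phi k t))%R.

Lemma measurable_mixture (V : 'I_m -> {RV Pr >-> R}) :
  measurable_fun setT (mixture V).
Proof.
apply: measurable_sum => k; apply: measurable_funM.
  exact: measurable_indic.
exact: measurableT_comp.
Qed.

Lemma mixtureE (V : 'I_m -> T -> R) k t : I k t -> mixture V t = V k (phi k t).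
Proof.
move=> It; rewrite /mixture (bigD1 k)//= indicE mem_set// mul1r.
rewrite big1 ?addr0// => l lk; rewrite indicE memNset ?mul0r// => Ilt.
by move/eqP : lk; apply; apply: (tI (i:=l) (j:=k)) => //; exists t.
Qed.

Lemma mixture0 (V : 'I_m -> T -> R) t : (forall k, ~ I k t) ->
  mixture V t = 0%R.
Proof.
by move=> It; rewrite /mixture big1// => k _; rewrite indicE memNset ?mul0r.
Qed.

Lemma is_uniform_mixture (V : 'I_m -> {RV Pr >-> R}) :
  (forall k, is_uniform (V k)) -> is_uniform (mkRV Pr' (measurable_mixture V)).
Proof.
move=> UV; split=> [t|x x01]; rewrite mkRVE.
  have [[k It]|It] := pselect (exists k, I k t).
    by rewrite (mixtureE _ It); exact: (UV k).1.
  rewrite mixture0 ?lexx ?ler01// => k Ikt; apply: It; by exists k.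
rewrite (@mixture_prob _ (fun k => V k @^-1` `]-oo, x])).
- under eq_bigr => k _ do rewrite (UV k).2// -EFinM.
  by rewrite sumEFin -mulr_suml w1 mul1r.
- by rewrite -[X in measurable X]setTI; exact: measurable_mixture.
- by move=> k; exact: measurable_funPTI.
- by move=> k; apply/seteqP; split => t [It] /=; rewrite (mixtureE _ It).
Qed.

Lemma mean_mixture (V W : 'I_m -> {RV Pr >-> R}) :
  (forall k, is_uniform (V k)) -> (forall k, is_uniform (W k)) ->
  mean Pr' (fun t => mixture V t * mixture W t)%R
  = (\sum_k w k * mean Pr (fun t => V k t * W k t))%R.
Proof.
move=> UV UW; apply: EFin_inj.
have UV' := is_uniform_mixture UV; have UW' := is_uniform_mixture UW.
rewrite -sumEFin.
under [RHS]eq_bigr => k _ do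
  rewrite EFinM -(meanE (Lfun1_uniformM (UV k) (UW k))).
have := Lfun1_uniformM UV' UW'; rewrite !mkRVE => lf; rewrite -(meanE lf).
have mZ' : measurable_fun setT (fun t => mixture V t * mixture W t)%R.
  by apply: measurable_funM; exact: measurable_mixture.
have mZ k : measurable_fun setT (fun t => V k t * W k t)%R.
  exact: measurable_funM.
apply: (@mixture_expectation (mkRV Pr' mZ') (fun k => mkRV Pr (mZ k))).
- move=> t; have := (UV'.1 t); have := (UW'.1 t); rewrite !mkRVE.
  by move=> /andP[? _] /andP[? _]; exact: mulr_ge0.
- move=> k t; have /andP[? _] := (UV k).1 t; have /andP[? _] := (UW k).1 t.
  by rewrite mkRVE mulr_ge0.
- by move=> k t It; rewrite !mkRVE !(mixtureE _ It).
Qed.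

End Mixture.
(** * Splitting a uniform variable *)

Section Slices.
Context (R : realType) (m : nat) (w : 'I_m -> R).
Hypotheses (w0 : forall k, 0 <= w k) (w1 : \sum_k w k = 1).
Local Notation unif := (uniform_prob (@ltr01 R)).

(** [0, 1] is cut into consecutive intervals (a_k, a_k + w_k]. *)
Definition slice_start (k : 'I_m) : R := \sum_(j < m | (j < k)%N) w j.

Definition slice (k : 'I_m) : set R :=
  `]slice_start k, slice_start k + w k]%classic.

Lemma slice_start_ge0 k : 0 <= slice_start k.
Proof. exact: sumr_ge0. Qed.

Lemma slice_start_next (j k : 'I_m) : (j < k)%N ->
  slice_start j + w j <= slice_start k.
Proof.
move=> jk; rewrite /slice_start (bigD1 (P := fun i : 'I_m => (i < k)%N) j)//=.
rewrite [leLHS]addrC lerD2l [leRHS](bigID (fun i : 'I_m => (i < j)%N))/=.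
rewrite [leLHS](_ : _ =
  \sum_(i < m | ((i < k)%N && (i != j)) && (i < j)%N) w i).
  by rewrite lerDl; apply: sumr_ge0.
apply: eq_bigl => i; have [ij|] := ltnP i j; rewrite ?andbF ?andbT//.
by rewrite (ltn_trans ij jk)/= -val_eqE (ltn_eqF ij).
Qed.

Lemma slice_end_le1 k : slice_start k + w k <= 1.
Proof.
rewrite -w1 (bigD1 k)//= [leLHS]addrC lerD2l.
rewrite [leRHS](bigID (fun i : 'I_m => (i < k)%N))/=.
rewrite [leLHS](_ : _ = \sum_(i < m | (i != k) && (i < k)%N) w i).
  by rewrite lerDl; apply: sumr_ge0.
apply: eq_bigl => i; have [ik|] := ltnP i k; rewrite ?andbF ?andbT//.
by rewrite -val_eqE (ltn_eqF ik).
Qed.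

Lemma trivIset_slice : trivIset setT slice.
Proof.
have lt_disj (j k : 'I_m) u : (j < k)%N -> slice j u -> slice k u -> False.
  rewrite /slice /= !in_itv/= => jk /andP[_ uj] /andP[uk _].
  by have := lt_le_trans uk (le_trans uj (slice_start_next jk)); rewrite ltxx.
move=> j k _ _ [u [uj uk]]; apply/val_inj.
have [jk|kj|//] := ltngtP j k.
  by case: (lt_disj _ _ _ jk uj uk).
by case: (lt_disj _ _ _ kj uk uj).
Qed.

Lemma uniform_prob_itvoc (a b : R) : 0 <= a -> a <= b -> b <= 1 ->
  unif `]a, b]%classic = (b - a)%:E.
Proof.
move=> a0 ab b1; rewrite uniform_probE//.
rewrite (_ : _ `&` _ = `]a, b]%classic); last first.
  apply/setIidl => u /=; rewrite !in_itv/= => /andP[au ub].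
  by apply/andP; split; lra.
rewrite lebesgue_measure_itv/= lte_fin -EFinB.
by case: ltP => // ba; congr (_%:E); lra.
Qed.

(** When w_k > 0, the increasing affine map from the k-th interval onto
    (0, 1]. *)
Definition rescale (k : 'I_m) (u : R) : R := (u - slice_start k) / w k.

Lemma measurable_rescale k : measurable_fun setT (rescale k).
Proof. by apply: measurable_funM => //; exact: measurable_funB. Qed.

Lemma uniform_prob_slice (k : 'I_m) : unif (slice k) = (w k)%:E.
Proof.
rewrite /slice uniform_prob_itvoc ?slice_start_ge0 ?slice_end_le1 ?lerDl//.
by rewrite addrC addKr.
Qed.

Lemma uniform_prob_rescale k (A : set R) : measurable A ->
  unif (slice k `&` rescale k @^-1` A) = ((w k)%:E * unif A)%E.
Proof.
move=> mA; have [wk0|wk_neq0] := eqVneq (w k) 0.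
  rewrite wk0 mul0e (_ : _ `&` _ = set0) ?measure0//.
  apply/seteqP; split => // u [+ _]; rewrite /slice /= in_itv/= wk0 addr0.
  by move=> /andP[+ ?]; rewrite ltNge => /negP; apply.
have wk_gt0 : 0 < w k by rewrite lt_neqAle eq_sym wk_neq0 w0.
have mI : measurable (slice k : set (measurableTypeR R)).
  exact: measurable_itv.
have mf : measurable_fun setT
    (rescale k : measurableTypeR R -> measurableTypeR R).
  exact: measurable_rescale.
pose m1 := pushforward (mrestr unif mI)
  (rescale k : measurableTypeR R -> measurableTypeR R).
pose m2 := mscale (NngNum (w0 k)) unif.
suff : m1 A = m2 A by rewrite /m1 /m2 /pushforward /mrestr /mscale /= setIC.
move: A mA; refine (@eq_measure_rays R m1 m2 _ _).
  rewrite /m1 /= /pushforward /mrestr /= preimage_setT setTI.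
  by rewrite uniform_prob_slice ltry.
move=> x; rewrite /m1 /m2 /= /pushforward /mrestr /mscale /=.
have preim : rescale k @^-1` `]-oo, x]
    = `]-oo, slice_start k + w k * x]%classic.
  apply/seteqP; split => u /=; rewrite !in_itv/= /rescale ler_pdivrMr//; lra.
rewrite preim; have [x0|x0] := ltP x 0.
  rewrite uniform_prob_ray_lt0// mule0 (_ : _ `&` _ = set0) ?measure0//.
  apply/seteqP; split => // u [] /=; rewrite /slice /= !in_itv/=.
  by move=> ? /andP[? _]; have := mulr_gt0 wk_gt0 (_ : 0 < - x); nra.
have [x1|x1] := leP x 1.
  rewrite uniform_prob_ray ?x0// -EFinM.
  rewrite (_ : _ `&` _ = `]slice_start k, slice_start k + w k * x]%classic).
    rewrite uniform_prob_itvoc ?slice_start_ge0//.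
    - by rewrite addrC addKr.
    - by rewrite lerDl mulr_ge0// w0.
    - by apply: le_trans (slice_end_le1 k); rewrite lerD2l ler_piMr ?w0.
  apply/seteqP; split => u /=; rewrite /slice /= !in_itv/=.
    by move=> [? /andP[? ?]]; apply/andP; split.
  move=> /andP[? ux]; split => //; apply/andP; split => //.
  by apply: le_trans ux _; rewrite lerD2l ler_piMr ?w0.
rewrite uniform_prob_ray_gt1// mule1 (_ : _ `&` _ = slice k).
  exact: uniform_prob_slice.
apply/setIidr => u; rewrite /slice /= !in_itv/= => /andP[_ /le_trans]; apply.
by rewrite lerD2l ler_peMr ?w0// ltW.
Unshelve. exact: mf.
Qed.

End Slices.

Lemma splits_uniform (R : realType) :
  splits (uniform_prob (@ltr01 R)) (uniform_prob (@ltr01 R)).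
Proof.
move=> m w w0 w1; exists (slice w), (rescale w); split.
- by move=> k; exact: measurable_itv.
- exact: trivIset_slice.
- exact: measurable_rescale.
- by move=> k A mA; exact: uniform_prob_rescale.
Qed.

Lemma splits_product (disp : measure_display) (T : measurableType disp)
    (R : realType) (Pr : probability T R) :
  splits Pr (Pr \x uniform_prob (@ltr01 R))%E.
Proof.
move=> m w w0 w1; exists (fun k => setT `*` slice w k), (fun _ => fst); split.
- by move=> k; apply: measurableX => //; exact: measurable_itv.
- move=> j k _ _ [[t u] /= [[_ uj] [_ uk]]].
  by apply: (trivIset_slice w0) => //; exists u.
- by move=> k; exact: measurable_fst.
- move=> k A mA; rewrite (_ : _ `&` _ = A `*` slice w k); last first.
    by apply/seteqP; split; case=> t u /= [] //; case.
  rewrite muleC -(uniform_prob_slice w0 w1).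
  by apply: product_measure1E => //; exact: measurable_itv.
Qed.
(** * The block mixture *)

Section BlockMixture.
Context (disp disp' : measure_display) (T : measurableType disp)
  (T' : measurableType disp') (R : realType)
  (Pr : probability T R) (Pr' : probability T' R).
Context (n S : nat) (b : 'I_n -> 'I_S) (c : 'I_S -> R).
Context (U : 'I_S -> {RV Pr >-> R}).
Hypothesis UU : forall s, is_uniform (U s).
Hypothesis c01 : forall s, 0 <= c s <= 1.
Hypothesis c1 : forall s, #|block b s| = 1%N -> c s = 1.

Local Notation states := {ffun 'I_S -> option 'S_n}.

Lemma preserves_uniform_state_map i a :
  preserves_uniform (@state_map R n S b i a).
Proof.
case: a => [p|]; first exact: preserves_uniform_joint_mix.
exact: preserves_uniform_id.
Qed.

Lemma measurable_component (k : states) i :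
  measurable_fun setT (fun t => state_map b i (k (b i)) (U (b i) t)).
Proof.
have [mg _ _] := preserves_uniform_state_map i (k (b i)).
exact: measurableT_comp.
Qed.

(** The component i of the vector given the states k of the blocks. *)
Definition component (k : states) (i : 'I_n) : {RV Pr >-> R} :=
  mkRV Pr (measurable_component k i).

Lemma is_uniform_component k i : is_uniform (component k i).
Proof.
by apply: (is_uniform_comp _ (UU (b i)));
  [exact: (preserves_uniform_state_map i (k (b i)))|].
Qed.

(** The mixed second moment E[X_i X_j] of the mixture. *)
Definition comoment (i j : 'I_n) : R :=
  \sum_k states_weight b c k
    * mean Pr (fun t => component k i t * component k j t).

Lemma comomentE i j : comoment i j =
  mean Pr (fun t => \sum_k states_weight b c k
    * (state_map b i (k (b i)) (U (b i) t)
       * state_map b j (k (b j)) (U (b j) t))).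
Proof.
have lf k : (fun t => component k i t * component k j t) \in Lfun Pr 1.
  by apply: Lfun1_uniformM; exact: is_uniform_component.
rewrite mean_sum; last by move=> k _; apply: Lfun1Z; exact: lf.
by apply: eq_bigr => k _; rewrite meanZ//; exact: lf.
Qed.

Lemma comoment_diag i : 12 * comoment i i - 3 = 1.
Proof.
rewrite /comoment.
under eq_bigr => k _ do rewrite (mean_uniform_sqr (is_uniform_component k i)).
by rewrite -mulr_suml sum_states_weight0; lra.
Qed.

(** Spearman's rho, 12 E[X_i X_j] - 3, of components in different blocks. *)
Lemma comoment_across i j : b i != b j ->
  12 * comoment i j - 3
  = c (b i) * c (b j) * (12 * mean Pr (fun t => U (b i) t * U (b j) t) - 3).
Proof.
move=> bij; rewrite comomentE.
set s := b i; set s' := b j; rewrite -/s -/s' in bij.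
have lUU : (fun t => U s t * U s' t) \in Lfun Pr 1 by exact: Lfun1_uniformM.
have lU z : (fun t => U z t) \in Lfun Pr 1 by exact: Lfun1_uniform.
have -> : (fun t => \sum_k states_weight b c k *
      (state_map b i (k s) (U s t) * state_map b j (k s') (U s' t)))
  = fun t => c s * c s' * (U s t * U s' t) +
     (c s * (1 - c s') / 2 * U s t +
     (c s' * (1 - c s) / 2 * U s' t + (1 - c s) * (1 - c s') / 4)).
  apply/funext => t.
  rewrite (sum_states_weight2 b c (fun a => state_map b i a (U s t))
     (fun a => state_map b j a (U s' t)) bij).
  by rewrite !mean_state_map; [rewrite -/s -/s'; field|exact: c1|exact: c1].
rewrite !meanD ?meanZ ?mean_cst ?mean_uniform//;
  do ?[exact: Lfun1Z|exact: Lfun1_cst|apply: Lfun1D].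
by field.
Qed.

(** Spearman's rho of distinct components of the same block. *)
Lemma comoment_within i j : b i = b j -> i != j ->
  12 * comoment i j - 3
  = c (b i) - (1 - c (b i)) / (#|block b (b i)|%:R - 1).
Proof.
move=> bij ij; rewrite comomentE -bij.
set s := b i; pose N : R := #|block b s|%:R.
have N2 : (2 <= #|block b s|)%N.
  have jA : j \in block b s by rewrite inE /s bij.
  by rewrite (cardD1 i) mem_block (cardD1 j) !inE eq_sym ij /s bij eqxx.
have N0 : N != 0 by rewrite pnatr_eq0 -lt0n ltnW.
have N1 : N - 1 != 0 by rewrite subr_eq0 (eqr_nat _ _ 1) gtn_eqF.
have mM p : measurable_fun setT (fun t => mix_map b s p (U s t)).
  by apply: measurableT_comp => //; case: (preserves_uniform_joint_mix R
    #|block b s| (index p (enum (block b s)))).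
pose M p := mkRV Pr (mM p).
have UM p : is_uniform (M p).
  by apply: (is_uniform_comp (preserves_uniform_joint_mix R _ _) (UU s)).
have lMM p : (fun t => M p t * M p t) \in Lfun Pr 1 by exact: Lfun1_uniformM.
have lUU : (fun t => U s t * U s t) \in Lfun Pr 1 by exact: Lfun1_uniformM.
have -> : (fun t => \sum_k states_weight b c k *
      (state_map b i (k s) (U s t) * state_map b j (k s) (U s t)))
  = fun t => c s * (U s t * U s t) +
     (- (1 - c s) / (N * (N - 1)) * (\sum_(p in block b s) M p t * M p t) +
      (1 - c s) * (N / 2) ^+ 2 / (N * (N - 1))).
  apply/funext => t.
  rewrite (sum_states_weight1 b c s
    (fun a => state_map b i a (U s t) * state_map b j a (U s t))).
  rewrite (mean_state_map2 c (U s t) bij ij) -/s -/N.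
  under [in RHS]eq_bigr => p _ do rewrite -expr2.
  by rewrite -/(mix_map _ _ _ _) -expr2; field; rewrite N0 N1.
have lS : (fun t => \sum_(p in block b s) M p t * M p t) \in Lfun Pr 1.
  by apply: Lfun1_sum.
rewrite !meanD ?meanZ ?mean_cst ?mean_uniform_sqr//;
  do ?[exact: Lfun1Z|exact: Lfun1_cst|apply: Lfun1D].
rewrite mean_sum//; under eq_bigr => p _ do rewrite (mean_uniform_sqr (UM p)).
rewrite sumr_const -mulr_natr -/N; field; rewrite N0 N1//.
Qed.

Lemma exists_block_mixture : splits Pr Pr' ->
  exists X : 'I_n -> {RV Pr' >-> R},
    (forall i, is_uniform (X i)) /\
    (forall i j, mean Pr' (fun t => X i t * X j t) = comoment i j).
Proof.
pose w (l : 'I_#|{: states}|) := states_weight b c (enum_val l).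
have sumE (F : states -> R) :
    \sum_(l < #|{: states}|) F (enum_val l) = \sum_k F k.
  rewrite [RHS](reindex (enum_val (A := {: states})))//.
  exact/onW_bij/enum_val_bij.
have w0 l : 0 <= w l by exact: states_weight_ge0.
have w1 : \sum_l w l = 1 by rewrite sumE sum_states_weight0.
move=> /(_ _ w w0 w1)[I [phi [mI tI mphi Pphi]]].
pose V i (l : 'I_#|{: states}|) := component (enum_val l) i.
have UV i l : is_uniform (V i l) by exact: is_uniform_component.
exists (fun i => mkRV Pr' (measurable_mixture mI mphi (V i))); split => [i|i j].
  exact: (is_uniform_mixture w1 mI tI mphi Pphi (UV i)).
rewrite /comoment -sumE.
exact: (mean_mixture w0 w1 mI tI mphi Pphi (UV i) (UV j)).
Qed.

End BlockMixture.
(** * Block homogeneous correlation matrices *)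

Section BlockHomogeneousEntries.
Context (R : realType) (S : nat) (d : 'I_S -> nat) (rho : 'M[R]_S)
  (P : 'M[R]_(\sum_s d s)).
Hypothesis bhP : block_homogeneous rho P.
Local Notation blk := (block (@tagnat.sig1 S d)).

Lemma card_blk s : #|blk s| = d s.
Proof.
rewrite (_ : blk s = [set @tagnat.Rank _ _ s k | k : 'I_(d s)]%SET).
  rewrite card_imset ?card_ord// => k l /(congr1 val)/eqP.
  by rewrite tagnat.eq_Rank eqxx => /eqP/val_inj.
apply/setP => i; rewrite inE; apply/eqP/imsetP => [<-|[k _ ->]].
  by exists (tagnat.sig2 i); rewrite ?tagnat.sig2K.
by rewrite tagnat.Rank1K.
Qed.

Lemma block_homogeneous_diag i : P i i = 1.
Proof. by have [_ _ -> _ _] := bhP. Qed.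

Lemma block_homogeneous_within i j :
  tagnat.sig1 i = tagnat.sig1 j -> i != j ->
  P i j = rho (tagnat.sig1 i) (tagnat.sig1 i).
Proof.
have H s t (k : 'I_(d s)) (l : 'I_(d t)) : s = t ->
    tagnat.Rank s k != tagnat.Rank t l ->
    P (tagnat.Rank s k) (tagnat.Rank t l) = rho s s.
  move=> st; rewrite {}st in k * => kl.
  have [_ _ _ /(_ t)/matrixP/(_ k l) + _] := bhP.
  rewrite !mxE => ->; rewrite mulr1.
  have [ekl|_] := eqVneq k l; first by rewrite ekl eqxx in kl.
  by rewrite mulr0 add0r.
move=> sij ij; have := H _ _ (tagnat.sig2 i) (tagnat.sig2 j) sij.
by rewrite !tagnat.sig2K; exact.
Qed.

Lemma block_homogeneous_across i j :
  tagnat.sig1 i != tagnat.sig1 j ->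
  P i j = rho (tagnat.sig1 i) (tagnat.sig1 j).
Proof.
move=> ij.
have [_ _ _ _ /(_ _ _ ij)/matrixP/(_ (tagnat.sig2 i) (tagnat.sig2 j))] := bhP.
by rewrite !mxE !tagnat.sig2K mulr1.
Qed.

(** The probability with which all components of block s are equal. *)
Definition selection_prob (s : 'I_S) : R :=
  (1 + ((d s)%:R - 1) * rho s s) / (d s)%:R.

Hypothesis d1 : forall s, (1 <= d s)%N.
Hypothesis psdP : psd_mx P.

Lemma natd_gt0 s : 0 < (d s)%:R :> R.
Proof. by rewrite ltr0n; exact: d1. Qed.

(** The quadratic form of P at the indicator vector of block s is
    d_s (1 + (d_s - 1) rho_ss). *)
Lemma selection_prob_ge0 s : 0 <= selection_prob s.
Proof.
rewrite divr_ge0 ?ler0n// -(pmulr_rge0 _ (natd_gt0 s)).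
have := psdP (\col_i (i \in blk s)%:R).
suff -> : ((\col_i (i \in blk s)%:R)^T *m P *m (\col_i (i \in blk s)%:R)) 0 0
    = (d s)%:R * (1 + ((d s)%:R - 1) * rho s s) by [].
rewrite mxE.
transitivity (\sum_(j in blk s) \sum_(i in blk s) P i j).
  rewrite [RHS]big_mkcond/=; apply: eq_bigr => j _; rewrite !mxE.
  case: ifP => _; rewrite ?mulr0// mulr1 [RHS]big_mkcond/=.
  by apply: eq_bigr => i _; rewrite !mxE; case: ifP => _; rewrite ?mul1r ?mul0r.
transitivity (\sum_(j in blk s) (1 + ((d s)%:R - 1) * rho s s)); last first.
  by rewrite sumr_const card_blk mulr_natl.
apply: eq_bigr => j js; rewrite (bigD1 j)//= block_homogeneous_diag.
congr (_ + _); rewrite (eq_bigr (fun=> rho s s)); last first.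
  move=> i /andP[]; move: js; rewrite !inE => /eqP js /eqP si ij.
  by rewrite block_homogeneous_within ?si ?js.
rewrite sumr_const -[LHS]mulr_natl; congr (_ * _).
rewrite -card_blk [in RHS](cardD1 j) js natrD addrC addKr; congr (_%:R).
by apply: eq_card => l; rewrite [LHS]unfold_in !inE andbC.
Qed.

Lemma selection_prob_le1 s : selection_prob s <= 1.
Proof.
rewrite ler_pdivrMr ?natd_gt0// mul1r.
have [d_s1|ds2] : d s = 1%N \/ (2 <= d s)%N.
  by have := d1 s; case: (d s) => [|[|]]; auto.
  by rewrite d_s1; lra.
have rho1 : rho s s <= 1.
  have : (1 < #|blk s|)%N by rewrite card_blk.
  case/card_gt1P => i [j [+ + ij]]; rewrite !inE => /eqP si /eqP sj.
  rewrite -[s in rho s _]si -[s in rho _ s]si.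
  rewrite -(block_homogeneous_within _ ij) ?si//.
  by have [_ /(_ i j)/andP[]] := bhP.
have dge1 : 1 <= (d s)%:R :> R by rewrite ler1n; exact: d1.
by nra.
Qed.

End BlockHomogeneousEntries.

Lemma has_rhoS_matrix_uniform (disp : measure_display)
    (T : measurableType disp) (R : realType) (Pr : probability T R) (n : nat)
    (X : 'I_n -> {RV Pr >-> R}) (Q : 'M[R]_n) :
  (forall i, is_uniform (X i)) ->
  (forall i j, Q i j = 12 * mean Pr (fun t => X i t * X j t) - 3) ->
  has_rhoS_matrix X Q.
Proof.
move=> UX QE; split => [i|i j]; first exact: continuous_df_uniform.
by rewrite spearman_uniform.
Qed.

Section Construction.
Context (disp disp' : measure_display) (T : measurableType disp)
  (T' : measurableType disp') (R : realType)
  (Pr : probability T R) (Pr' : probability T' R).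

(** The probability spaces enter only through [splits]. *)
Lemma block_homogeneous_construction (S : nat) (d : 'I_S -> nat)
    (rho : 'M[R]_S) (P : 'M[R]_(\sum_s d s)) (Y : 'I_S -> {RV Pr >-> R}) :
  (forall s, (1 <= d s)%N) ->
  block_homogeneous_corr rho P ->
  (forall s, 1 + ((d s)%:R - 1) * rho s s != 0) ->
  has_rhoS_matrix Y (block_reduction d rho) -> splits Pr Pr' ->
  exists X : 'I_(\sum_s d s) -> {RV Pr' >-> R}, has_rhoS_matrix X P.
Proof.
move=> d1 [bhP psdP] rho0 [cY ME] spl.
pose U s := mkRV Pr (measurable_df (Y s)).
have UU s : is_uniform (U s) by exact: is_uniform_df.
pose c s := selection_prob d rho s.
have c01 s : 0 <= c s <= 1.
  by rewrite (selection_prob_ge0 bhP)// (selection_prob_le1 bhP).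
have [X [UX mX]] := exists_block_mixture (@tagnat.sig1 S d) UU c01 spl.
have c1 s : #|block (@tagnat.sig1 S d) s| = 1%N -> c s = 1.
  by rewrite card_blk /c /selection_prob => ->; rewrite subrr mul0r addr0 divr1.
exists X; apply: has_rhoS_matrix_uniform => // i j; rewrite mX.
have [<-|ij] := eqVneq i j.
  by rewrite comoment_diag// (block_homogeneous_diag bhP).
have d0 s : (d s)%:R != 0 :> R by rewrite lt0r_neq0 ?natd_gt0.
have [sij|sij] := eqVneq (tagnat.sig1 i) (tagnat.sig1 j).
  rewrite comoment_within// (block_homogeneous_within bhP)// card_blk.
  rewrite /c /selection_prob; set s := tagnat.sig1 i.
  have N1 : (d s)%:R - 1 != 0 :> R.
    have : (1 < #|block (@tagnat.sig1 S d) s|)%N.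
      by apply/card_gt1P; exists i, j; rewrite !inE -sij eqxx.
    by rewrite card_blk subr_eq0 (eqr_nat _ _ 1) => /gtn_eqF ->.
  by field; rewrite N1 d0.
rewrite comoment_across// (block_homogeneous_across bhP)//.
set s := tagnat.sig1 i; set t := tagnat.sig1 j; rewrite -/s -/t in sij.
have -> : 12 * mean Pr (fun x => U s x * U t x) - 3 = block_reduction d rho s t.
  by rewrite ME -pearson_uniform.
rewrite mxE (negbTE sij) /c /selection_prob; field.
by rewrite !rho0 !d0.
Qed.

End Construction.

Theorem proposition8 (R : realType) (S : nat) (d : 'I_S -> nat)
    (rho : 'M[R]_S) (P : 'M[R]_(\sum_s d s)) :
  (0 < S)%N ->
  (forall s, (1 <= d s)%N) ->
  (forall s t, rho s t = rho t s) ->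
  block_homogeneous_corr rho P ->
  (forall s, 1 + ((d s)%:R - 1) * rho s s != 0) ->
  (rhoS_set S (block_reduction d rho) -> rhoS_compatible P) /\
  (rhoS_attainable (block_reduction d rho) -> rhoS_attainable P).
Proof.
move=> S0 d1 rhoC corrP rho0.
have compat : rhoS_set S (block_reduction d rho) -> rhoS_compatible P.
  case=> _ [disp [T [Pr [Y MY]]]]; split; first by case: corrP => -[].
  have [X XP] := block_homogeneous_construction d1 corrP rho0 MY
    (splits_product Pr).
  by exists _, _, _, X.
split => // -[compM [Y MY]]; split; first exact: compat.
exact: (block_homogeneous_construction d1 corrP rho0 MY (@splits_uniform R)).
Qed.
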